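(* Let $G$ be a connected graph of order at least $2$ and $x$ a vertex of $G$. Then, for any choices made in defining $av(G,x)$, \[ av(G,x)\cdot\big(N(G,x)-1\big)\geq N(G-x).\]
   Context: A set of vertices is a connected set if it induces a connected subgraph. $G-x$ is the subgraph induced by $V(G)\setminus\{x\}$; $\mathcal C(G-x)$ is the collection of nonempty connected sets of $G-x$ and $N(G-x)=|\mathcal C(G-x)|$. $\mathcal C(G,x)$ is the collection of connected sets of $G$ containing $x$ and $N(G,x)=|\mathcal C(G,x)|$. Definition of $av(G,x)$: fix a shortest distance spanning tree $T$ of $G$ rooted at $x$ (for each vertex $v$, the path in $T$ from $v$ to $x$ has length equal to the distance from $v$ to $x$ in $G$). For each $U\in\mathcal C(G-x)$ choose a vertex $v_U\in U$ closest to $x$, and let $p_U$ be the path in $T$ between $v_U$ and $x$, regarded as its vertex set; $|p_U|$ denotes its length (number of edges). Let $\overline U=U\cup p_U$. For $Q\in\mathcal C(G,x)$ let $W(Q)=\{U\in\mathcal C(G-x):\overline U=Q\}$, ordered by $U\preceq U'$ iff $p_{U'}\subseteq p_U$; when $W(Q)\ne\emptyset$ let $U_Q$ be the minimal element of $W(Q)$ for this order. Let $\mathcal M(G-x)=\{U_Q: Q\in\mathcal C(G,x),\ W(Q)\neq\emptyset\}$ and \[av(G,x)=\frac{1}{|\mathcal M(G-x)|}\sum_{U\in\mathcal M(G-x)}|p_U|.\] *)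

(* Defs.v *)
From mathcomp Require Import all_boot all_order all_algebra.

Set Implicit Arguments.
Unset Strict Implicit.
Unset Printing Implicit Defensive.

Import Order.TTheory GRing.Theory Num.Theory.

(* A graph on the finite vertex type V is given by its adjacency relation. *)

Section Graphs.
Variables (V : finType) (e : rel V).

Definition simple_graph : Prop := symmetric e /\ irreflexive e.

Definition connected_graph : Prop := forall u v : V, connect e u v.

Definition induced (S : {set V}) : rel V :=
  [rel u v | [&& u \in S, v \in S & e u v]].

(* The empty set is connected in this sense; the families below exclude it. *)
Definition connected_set (S : {set V}) : bool :=
  [forall u in S, forall v in S, connect (induced S) u v].

(* u :: s is the vertex sequence of a path from u to v, and size s is its
   length (number of edges). *)
Definition is_path (u v : V) (s : seq V) : bool :=
  [&& path e u s, last u s == v & uniq (u :: s)].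

(* There is a walk with n edges from u to v. *)
Definition walk (u v : V) (n : nat) : bool :=
  [exists s : n.-tuple V, path e u s && (last u s == v)].

(* The least length of a walk from u to v; the value is #|V| if there is none,
   since a shortest walk has length less than #|V|. *)
Definition dist (u v : V) : nat := find (walk u v) (iota 0 #|V|).

Definition acyclic : Prop := forall c : seq V, ucycle e c -> size c < 3.

Definition is_tree : Prop := [/\ simple_graph, connected_graph & acyclic].

(* C(G - x): a subset of V \ {x} induces the same subgraph in G - x and in G. *)
Definition conn_del (x : V) : {set {set V}} :=
  [set U : {set V} | [&& U != set0, x \notin U & connected_set U]].

(* C(G, x) *)
Definition conn_at (x : V) : {set {set V}} :=
  [set Q : {set V} | (x \in Q) && connected_set Q].

Definition closest (x : V) (U : {set V}) (v : V) : Prop :=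
  v \in U /\ forall u, u \in U -> dist v x <= dist u x.

End Graphs.

Definition shortest_distance_tree (V : finType) (e : rel V) (x : V)
    (t : rel V) : Prop :=
  [/\ is_tree t, subrel t e &
      forall (v : V) (s : seq V), is_path t v x s -> size s = dist e v x].

(* The choices made in defining av(G, x): the tree t, the vertices v U, and the
   paths p_U, whose vertex sequence is v U :: p U.  As t is a tree, p U is
   determined by t and v U. *)
Definition av_choice (V : finType) (e : rel V) (x : V)
    (t : rel V) (v : {set V} -> V) (p : {set V} -> seq V) : Prop :=
  shortest_distance_tree e x t /\
  forall U, U \in conn_del e x ->
    closest e x U (v U) /\ is_path t (v U) x (p U).

Section Average.
Variables (V : finType) (e : rel V) (x : V).
Variables (v : {set V} -> V) (p : {set V} -> seq V).

Definition pathset (U : {set V}) : {set V} := [set u in v U :: p U].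

Definition bar (U : {set V}) : {set V} := U :|: pathset U.

Definition W (Q : {set V}) : {set {set V}} :=
  [set U in conn_del e x | bar U == Q].

Definition prec (U U' : {set V}) : bool := pathset U' \subset pathset U.

Definition minimal_in (Q U : {set V}) : bool :=
  (U \in W Q) && [forall U' in W Q, prec U' U ==> (U' == U)].

(* The sets U_Q.  Under av_choice, prec is a linear order on each W Q, so a
   nonempty W Q has exactly one minimal element. *)
Definition M : {set {set V}} :=
  [set U : {set V} | [exists Q : {set V} in conn_at e x, minimal_in Q U]].

Definition av : rat :=
  ((\sum_(U in M) size (p U))%N%:R / #|M|%:R)%R.

End Average.

(* Main.v *)
Require Import Defs.
From mathcomp Require Import all_boot all_order all_algebra.
Import Order.TTheory GRing.Theory Num.Theory.

(** If [bar U = bar U' = Q] then [U] is obtained from [Q] by discarding the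
    vertices at distance less than [size (p U)] from [x], so a member of [W Q]
    is determined by the length of its path.  These lengths are positive, and
    the largest of them belongs to the minimal element [U_Q]; hence
    [#|W Q| <= size (p U_Q)], and summing over [Q] gives
    [N(G - x) <= \sum_(U in M) size (p U)].  On the other hand
    [#|M| <= N(G, x) - 1], since [W [set x]] is empty. *)

Section ClosestPath.
Set Implicit Arguments.
Unset Strict Implicit.

Variables (V : finType) (e : rel V) (x : V).
Variables (t : rel V) (v : {set V} -> V) (p : {set V} -> seq V).
Hypothesis e_sym : symmetric e.
Hypothesis vp_choice : av_choice e x t v p.

Lemma subset_connect_induced (S S' : {set V}) :
  S \subset S' -> subrel (connect (induced e S)) (connect (induced e S')).
Proof.
move=> /subsetP sSS'; apply: connect_sub => a b /and3P[Sa Sb e_ab].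
by apply/connect1/and3P; split=> //; apply: sSS'.
Qed.

Lemma induced_connect_sym (S : {set V}) : connect_sym (induced e S).
Proof.
by apply: sym_connect_sym => a b; rewrite /induced /= e_sym andbCA.
Qed.

Lemma path_connect_last (S : {set V}) (a : V) (s : seq V) (u : V) :
  path e a s -> {subset a :: s <= S} -> u \in a :: s ->
  connect (induced e S) u (last a s).
Proof.
elim: s a u => [|b s IHs] a u /=; first by move=> _ _; rewrite inE => /eqP->.
move=> /andP[e_ab e_bs] sS.
have sS' : {subset b :: s <= S} by move=> w ws; apply: sS; rewrite inE ws orbT.
rewrite inE => /predU1P[->|us]; last exact: IHs.
apply: connect_trans _ (IHs b b e_bs sS' (mem_head _ _)).
by apply/connect1/and3P; split=> //; [apply: sS | apply: sS']; apply: mem_head.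
Qed.

(** The part of a tree path after [u] is again a tree path to [x], so its length is the distance
    from [u]. It is a proper tail of [s], as [u] itself is an entry of [s]. *)
Lemma dist_on_tree_path (a u : V) (s : seq V) :
  is_path t a x s -> u \in s -> dist e u x < size s.
Proof.
case: vp_choice => [[_ _ tree_dist] _] + us.
case/splitPr: us => s1 s2.
rewrite /is_path cat_path last_cat -cat_cons cat_uniq /=.
move=> /and3P[/and3P[_ _ t_us2] last_x /and3P[_ _ uniq_us2]].
rewrite -(tree_dist u s2) ?size_cat /= ?addnS ?ltnS ?leq_addl //.
exact/and3P.
Qed.

Lemma dist_root (U : {set V}) : U \in conn_del e x ->
  dist e (v U) x = size (p U).
Proof.
case: vp_choice => [[_ _ tree_dist] vpP] /vpP[_ pU].
by rewrite (tree_dist _ _ pU).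
Qed.

Lemma size_path_le_dist (U : {set V}) (u : V) : U \in conn_del e x ->
  u \in U -> size (p U) <= dist e u x.
Proof.
move=> UC; rewrite -dist_root //.
by case: vp_choice => _ /(_ _ UC)[[_ +] _]; apply.
Qed.

Lemma dist_pathset (U : {set V}) (u : V) : U \in conn_del e x ->
  u \in pathset v p U -> u = v U \/ dist e u x < size (p U).
Proof.
case: vp_choice => _ vpP UC; have [_ pU] := vpP _ UC.
rewrite !inE => /predU1P[->|us]; [by left | right].
exact: dist_on_tree_path pU us.
Qed.

Lemma mem_root (U : {set V}) : U \in conn_del e x -> v U \in U.
Proof. by case: vp_choice => _ vpP /vpP[[]]. Qed.

Lemma size_path_gt0 (U : {set V}) : U \in conn_del e x -> 0 < size (p U).
Proof.
case: vp_choice => _ vpP UC; have [_ /and3P[_ last_x _]] := vpP _ UC.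
rewrite lt0n size_eq0; apply: contraTneq last_x => ->; apply/eqP => /= vUx.
have := mem_root UC; rewrite vUx; apply/negP.
by move: UC; rewrite inE => /and3P[].
Qed.

(** Every vertex of [bar v p U] reaches [x] inside this set: a vertex of [U] goes through [U] to
    [v U], and from there the path leads to [x]. *)
Lemma bar_conn_at (U : {set V}) : U \in conn_del e x ->
  bar v p U \in conn_at e x.
Proof.
case: vp_choice => [[_ te _] vpP] UC; have [_ /and3P[t_p /eqP last_x _]] := vpP _ UC.
have sP : {subset v U :: p U <= bar v p U}.
  by move=> u us; rewrite in_setU orbC inE us.
rewrite inE -[x in x \in _]last_x sP ?mem_last //=.
have toP u : u \in v U :: p U -> connect (induced e (bar v p U)) u x.
  rewrite -[X in connect _ u X]last_x; apply: path_connect_last => //.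
  exact: sub_path te _ _ t_p.
have toX u : u \in bar v p U -> connect (induced e (bar v p U)) u x.
  rewrite in_setU => /orP[uU|]; last by rewrite inE; apply: toP.
  apply: connect_trans _ (toP _ (mem_head _ _)).
  apply: (@subset_connect_induced U); first exact: subsetUl.
  move: (UC); rewrite inE => /and3P[_ _ /forall_inP/(_ _ uU)/forall_inP].
  by apply; exact: mem_root.
apply/forall_inP => a aQ; apply/forall_inP => b bQ.
by apply: connect_trans (toX a aQ) _; rewrite induced_connect_sym toX.
Qed.

Lemma bar_size_inj (U U' : {set V}) :
  U \in conn_del e x -> U' \in conn_del e x -> bar v p U = bar v p U' ->
  size (p U) = size (p U') -> U = U'.
Proof.
suff sub A B : A \in conn_del e x -> B \in conn_del e x ->
    bar v p A = bar v p B -> size (p A) = size (p B) -> A \subset B.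
  by move=> UC UC' eqb eqs; apply/eqP; rewrite eqEsubset !sub.
move=> AC BC eqb eqs; apply/subsetP => u uA.
have: u \in bar v p B by rewrite -eqb in_setU uA.
rewrite in_setU => /orP[//|/(dist_pathset BC)[->|]]; first exact: mem_root.
(* Here [u] would be closer to [x] than [size (p B) = size (p A)], too close for a member of [A]. *)
by rewrite ltnNge -eqs size_path_le_dist.
Qed.

(** When the lengths differ, the vertices of the shorter path are too close to [x] to lie in [U'],
    so within the common [bar] they must lie on the longer path. *)
Lemma prec_of_size (U U' : {set V}) :
  U \in conn_del e x -> U' \in conn_del e x -> bar v p U = bar v p U' ->
  size (p U) <= size (p U') -> prec v p U' U.
Proof.
move=> UC UC' eqb; rewrite leq_eqVlt => /predU1P[eqs|lts].
  by rewrite (bar_size_inj UC UC' eqb eqs) /prec subxx.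
apply/subsetP => u uP.
have: u \in bar v p U' by rewrite -eqb in_setU uP orbT.
rewrite in_setU => /orP[/(size_path_le_dist UC')|//].
rewrite leqNgt => /negP[]; apply: leq_ltn_trans lts.
have [->|/ltnW//] := dist_pathset UC uP.
by rewrite dist_root.
Qed.

(** The set [Q] in the definition of [M] can only be [bar v p U], which removes the existential. *)
Lemma mem_M (U : {set V}) : U \in M e x v p ->
  U \in conn_del e x /\
  forall U', U' \in W e x v p (bar v p U) -> prec v p U' U -> U' = U.
Proof.
rewrite inE => /exists_inP[Q _ /andP[]].
rewrite inE => /andP[UC /eqP-> /forall_inP minU]; split=> // U' WU' UU'.
exact/eqP/(implyP (minU _ WU')).
Qed.

Lemma size_path_le_M (U U' : {set V}) : U \in M e x v p ->
  U' \in W e x v p (bar v p U) -> size (p U') <= size (p U).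
Proof.
move=> /mem_M[UC minU] WU'; have := WU'; rewrite inE => /andP[UC' /eqP eqb].
case: leqP => // lt_UU'.
have eqU : U' = U by apply: minU => //; apply: prec_of_size (ltnW lt_UU').
by rewrite eqU ltnn in lt_UU'.
Qed.

Lemma card_W_le (U : {set V}) : U \in M e x v p ->
  #|W e x v p (bar v p U)| <= size (p U).
Proof.
move=> UM.
pose f (U' : {set V}) : 'I_(size (p U)).+1 := inord (size (p U')).
have fE U' : U' \in W e x v p (bar v p U) -> f U' = size (p U') :> nat.
  by move=> WU'; rewrite inordK // ltnS size_path_le_M.
rewrite -(@card_in_imset _ _ f); last first.
  move=> A B WA WB /(congr1 val) /=; rewrite !fE //.
  move: WA WB; rewrite inE => /andP[AC /eqP eqA].
  rewrite inE => /andP[BC /eqP eqB].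
  by apply: bar_size_inj; rewrite ?eqA ?eqB.
(* The lengths are positive, so [f] misses [ord0]; this saves the extra one in the type of [f]. *)
have cardC0 : #|[set~ (ord0 : 'I_(size (p U)).+1)]| = size (p U).
  by rewrite cardsC1 card_ord.
rewrite -[leqRHS]cardC0.
apply: subset_leq_card; apply/subsetP => _ /imsetP[U' WU' ->].
rewrite !inE -val_eqE /= fE // -lt0n size_path_gt0 //.
by move: WU'; rewrite inE => /andP[].
Qed.

Lemma conn_del_cover (U : {set V}) : U \in conn_del e x ->
  exists2 U', U' \in M e x v p & U \in W e x v p (bar v p U').
Proof.
move=> UC; have WU : U \in W e x v p (bar v p U) by rewrite inE UC eqxx.
(* The minimal element for [prec] is found as a member with the longest path. *)
case: (@arg_maxnP _ U [in W e x v p (bar v p U)] (fun A => size (p A)) WU).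
move=> U'; rewrite /= => WU' maxU'.
have := WU'; rewrite inE => /andP[UC' /eqP eqb].
exists U'; last by rewrite eqb.
rewrite inE; apply/exists_inP; exists (bar v p U); first exact: bar_conn_at.
rewrite /minimal_in WU' /=; apply/forall_inP => A WA; apply/implyP => precA.
have := WA; rewrite inE => /andP[AC /eqP eqA].
apply/eqP/bar_size_inj => //; first by rewrite eqA eqb.
apply/eqP; rewrite eqn_leq maxU' //= -dist_root //.
(* The path of [A] passes through [v U'], so it is at least as long as that of [U']. By maximality
   the lengths agree, and [bar_size_inj] applies. *)
have /(subsetP precA) : v U' \in pathset v p U' by rewrite inE mem_head.
case/(dist_pathset AC) => [->|/ltnW//].
by rewrite dist_root.
Qed.

Lemma card_conn_del_le :
  #|conn_del e x| <= \sum_(U in M e x v p) size (p U).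
Proof.
apply: (@leq_trans (\sum_(U in M e x v p) #|W e x v p (bar v p U)|)); last first.
  exact: leq_sum card_W_le.
apply: (@leq_trans #|\bigcup_(U in M e x v p) W e x v p (bar v p U)|).
  apply: subset_leq_card; apply/subsetP => U /conn_del_cover[U' MU' WU].
  by apply/bigcupP; exists U'.
elim/big_rec2: _ => [|U n A _ IH]; first by rewrite cards0.
exact: leq_trans (leq_card_setU _ _) (leq_add (leqnn _) IH).
Qed.

(** The map [bar] is injective on [M]: of two minimal sets with the same image, the one with the
    longer path precedes the other. It misses [[set x]], because an image contains [v U], which
    differs from [x]. *)
Lemma card_M_lt : #|M e x v p| < #|conn_at e x|.
Proof.
rewrite -(@card_in_imset _ _ (bar v p)); last first.
  move=> A B MA MB eqb.
  have [AC minA] := mem_M MA; have [BC minB] := mem_M MB.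
  have WA : A \in W e x v p (bar v p B) by rewrite inE AC eqb eqxx.
  have WB : B \in W e x v p (bar v p A) by rewrite inE BC eqb eqxx.
  by case/orP: (leq_total (size (p A)) (size (p B))) => les;
    [symmetry; apply: minA | apply: minB] => //; apply: prec_of_size.
apply: proper_card; apply/properP; split.
  by apply/subsetP => _ /imsetP[U /mem_M[UC _] ->]; apply: bar_conn_at.
exists [set x].
  rewrite inE set11; apply/forall_inP => a /set1P->.
  by apply/forall_inP => b /set1P->.
apply/imsetP => -[U /mem_M[UC _] eqb].
have: v U \in [set x] by rewrite eqb in_setU mem_root.
move=> /set1P vUx; have := mem_root UC; rewrite vUx.
by apply/negP; move: UC; rewrite inE => /and3P[].
Qed.

End ClosestPath.

Theorem theorem5p1 (V : finType) (e : rel V) (x : V)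
    (t : rel V) (v : {set V} -> V) (p : {set V} -> seq V) :
  simple_graph e -> connected_graph e -> (2 <= #|V|)%N ->
  av_choice e x t v p ->
  (av e x v p * (#|conn_at e x|%:R - 1) >= #|conn_del e x|%:R)%R.
Proof.
move=> [e_sym _] _ _ vpP.
have ltM := card_M_lt e_sym vpP.
have := card_conn_del_le e_sym vpP.
rewrite -(ler_nat rat) => /le_trans; apply.
have -> : (#|conn_at e x|%:R - 1 = #|conn_at e x|.-1%:R :> rat)%R.
  by rewrite -subn1 natrB // (leq_ltn_trans _ ltM).
rewrite /av.
(* If [M] is empty, the average divides by zero, but its numerator is an empty sum and both sides
   vanish. *)
have [M0|M_gt0] := posnP #|M e x v p|.
  by rewrite big_pred0 ?mul0r // => U; rewrite (cards0_eq M0) inE.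
rewrite mulrAC ler_pdivlMr ?ltr0n // ler_wpM2l ?ler0n // ler_nat.
by rewrite -ltnS (ltn_predK ltM).
Qed.
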